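(* Let $n,m\ge 1$ be integers, let $A_0,A_1,\ldots,A_m\in\mathbb{R}^{n\times n}$ and let $\tau_1,\ldots,\tau_m>0$. Let $X(t)\in\mathbb{R}^{n\times n}$ be the fundamental matrix of the linear delay differential system $$\dot{x}(t)=A_0x(t)+\sum_{j=1}^{m}A_jx(t-\tau_j).$$ Then this system is asymptotically stable if and only if the matrix $A_0+\sum_{j=1}^{m}A_j$ is invertible and the improper integral $\int_0^\infty X(\sigma)\,d\sigma$ converges with $$\int_0^\infty X(\sigma)\,d\sigma=-\Bigl(A_0+\sum_{j=1}^{m}A_j\Bigr)^{-1}.$$
   Context: The fundamental matrix $X:\mathbb{R}\to\mathbb{R}^{n\times n}$ of the system $\dot{x}(t)=A_0x(t)+\sum_{j=1}^{m}A_jx(t-\tau_j)$ is the unique function that is continuous on $[0,\infty)$ and satisfies $$\dot{X}(t)=A_0X(t)+\sum_{j=1}^{m}A_jX(t-\tau_j)\quad\text{for } t\ge 0,\qquad X(t)=0\ \text{for } t<0,\qquad X(0)=I,$$ where $I$ is the identity matrix and $\dot X(t)$ is understood as the right-hand derivative (at points such as $t=0$ and $t=\tau_j$ the two-sided derivative need not exist). Asymptotic stability of the system is characterized as follows: the system is asymptotically stable if and only if there exist constants $\alpha>0$ and $\gamma>0$ such that $\|X(t)\|\le\gamma\exp(-\alpha t)$ for all $t\in[0,\infty)$, where $\|\cdot\|$ is a matrix norm. The integral $\int_0^\infty X(\sigma)\,d\sigma$ is the entrywise improper integral $\lim_{t\to\infty}\int_0^tX(\sigma)\,d\sigma$ (absolute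 convergence is not presupposed). *)

(* Defs.v *)
From HB Require Import structures.
From mathcomp Require Import all_boot all_order all_algebra.
From mathcomp Require Import all_classical all_reals all_analysis.
Import Order.TTheory GRing.Theory Num.Theory.
Import numFieldNormedType.Exports.

Set Implicit Arguments.
Unset Strict Implicit.
Unset Printing Implicit Defensive.

Local Open Scope classical_set_scope.
Local Open Scope ring_scope.

(* A norm on the vector space of n x n matrices; submultiplicativity is not
   required, so every usual meaning of "matrix norm" is covered. *)
Definition is_matrix_norm (R : realType) (n : nat) (nrm : 'M[R]_n -> R) : Prop :=
  [/\ forall M, 0 <= nrm M,
      forall M, nrm M = 0 -> M = 0,
      forall (c : R) M, nrm (c *: M) = `|c| * nrm M
    & forall M N, nrm (M + N) <= nrm M + nrm N].

(* The fundamental matrix of x'(t) = A0 x(t) + \sum_j A_j x(t - tau_j).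
   The derivative is the right-hand one; the two-sided derivative fails to
   exist at 0 (X jumps from 0 to I) and may fail at the points tau_j. *)
Definition is_fundamental_matrix (R : realType) (n m : nat) (A0 : 'M[R]_n)
    (A : 'I_m -> 'M[R]_n) (tau : 'I_m -> R) (X : R -> 'M[R]_n) : Prop :=
  [/\ {within `[0, +oo[, continuous X},
      forall t, 0 <= t ->
        h^-1 *: (X (t + h) - X t) @[h --> 0^'+] -->
          A0 *m X t + \sum_(j < m) A j *m X (t - tau j),
      forall t, t < 0 -> X t = 0
    & X 0 = 1%:M].

(* Asymptotic stability is expressed by exponential decay of the fundamental
   matrix in the norm nrm. *)
Definition asymptotically_stable (R : realType) (n m : nat)
    (nrm : 'M[R]_n -> R) (A0 : 'M[R]_n) (A : 'I_m -> 'M[R]_n)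
    (tau : 'I_m -> R) : Prop :=
  exists2 X : R -> 'M[R]_n, is_fundamental_matrix A0 A tau X &
    exists alpha gamma : R, [/\ 0 < alpha, 0 < gamma &
      forall t, 0 <= t -> nrm (X t) <= gamma * expR (- alpha * t)].

(* \int_0^oo F = L as an entrywise limit of proper integrals. Rintegral is 0 by
   convention on non-integrable functions; this does not occur for F continuous
   on [0, +oo[, such as a fundamental matrix. *)
Definition improper_integral_eq (R : realType) (n : nat) (F : R -> 'M[R]_n)
    (L : 'M[R]_n) : Prop :=
  forall i j : 'I_n,
    (\int[@lebesgue_measure R]_(s in `[0, t]) F s i j) @[t --> +oo] --> L i j.

(* Main.v *)
Require Import Defs.
From HB Require Import structures.
From mathcomp Require Import all_boot all_order all_algebra.
From mathcomp Require Import all_classical all_reals all_analysis.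
From mathcomp Require Import ring lra.
Import Order.TTheory GRing.Theory Num.Theory.
Import numFieldNormedType.Exports.
Local Open Scope classical_set_scope.
Local Open Scope ring_scope.

(** Write S for the sum of A0 and all the A_j, and P(t) for the integral of X
    over [0, t].

    Both conditions of the theorem are equivalent to X(t) -> 0. Integrating the
    equation gives the balance
      X(t) = I + S P(t) - sum_j A_j (P(t) - P(t - tau_j))   for t >= 0.
    If X -> 0 then each P(t) - P(t - tau_j), an integral of X over a window of
    fixed length, tends to 0, so S P(t) -> -I. A row vector annihilated by S
    must then be 0, hence S is invertible and P(t) -> - S^-1
    (total_integral_of_cvg0). Conversely, if P(t) -> - S^-1 then
    P(t) - P(t - tau_j) -> 0 and the balance gives X(t) -> I - I = 0
    (cvg0_of_total_integral).

    It remains to see that X -> 0 forces exponential decay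
    (fundamental_matrix_exp_decay). This rests on the variation of constants
    formula (fundamental_matrix_variation_of_constants)
      X(t + s) = X(t) X(s)
        + sum_j int_0^tau_j X(t - v) A_j X(s + v - tau_j) dv,
    valid for s and t at least as large as every delay. In it every term
    contains a late value of X, which is small, and a value of X near time s. So
    after a fixed time lapse the supremum of |X| over a half-line has been
    halved, and halving over and over is exponential decay.

    The variation of constants formula is proved by differentiating
    u |-> X(t - u) X(s + u) and recognising the derivative of a sum of integrals.
    The derivative of the first factor must be expressed by the adjoint equation
    X' = X A0 + sum_j X(. - tau_j) A_j, with the coefficients on the right. That
    X solves it as well follows from uniqueness: the left and the right delay
    operators commute, so the difference of their values at P solves the delay
    equation with zero past and vanishes (delay_left_right_primitive).

    X is only known to be differentiable from the right, so the mean value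
    inequality is needed in its one-sided form (norm_le_of_has_rderiv). It replaces
    integration almost everywhere: antiderivatives are used through their
    derivative, and the Lebesgue integral appears only in the identification of
    P. Finally, stability is stated in an arbitrary norm while the estimates use
    the maximum norm of the entries; the two are equivalent. It also speaks of
    some fundamental matrix, which by uniqueness is X. *)

Set Implicit Arguments.
Unset Strict Implicit.
Unset Printing Implicit Defensive.

(** * Matrices with the maximum norm *)

Lemma entry_le_norm (R : realType) (m n : nat) (M : 'M[R]_(m, n)) i j :
  `|M i j| <= `|M|.
Proof.
rewrite [leRHS]/Num.Def.normr/= mx_normrE.
exact: (le_bigmax _ (fun k : 'I_m * 'I_n => `|M k.1 k.2|) (i, j)).
Qed.

Lemma norm_le_entries (R : realType) (m n : nat) (M : 'M[R]_(m, n)) (c : R) :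
  0 <= c -> (forall i j, `|M i j| <= c) -> `|M| <= c.
Proof.
move=> c0 Mc; rewrite [leLHS]/Num.Def.normr/= mx_normrE.
by apply: bigmax_le => // -[i j] _; exact: Mc.
Qed.

Lemma norm_mulmx_le (R : realType) (m n p : nat)
    (M : 'M[R]_(m, n)) (N : 'M[R]_(n, p)) :
  `|M *m N| <= n%:R * `|M| * `|N|.
Proof.
apply: norm_le_entries => [|i j]; first by rewrite !mulr_ge0.
rewrite mxE (le_trans (ler_norm_sum _ _ _))//.
rewrite (_ : n%:R * _ * _ = \sum_(k < n) `|M| * `|N|); last first.
  by rewrite sumr_const card_ord -mulrA mulr_natl.
by apply: ler_sum => k _; rewrite normrM ler_pM// entry_le_norm.
Qed.

Lemma cvg_mx_entries (R : realType) (m n : nat) (T : Type) (F : set_system T)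
    (FF : Filter F) (f : T -> 'M[R]_(m, n)) (L : 'M[R]_(m, n)) :
  (forall i j, f x i j @[x --> F] --> L i j) -> f x @[x --> F] --> L.
Proof.
move=> fL; apply/cvgrPdist_le => e e0.
have fe : \forall x \near F, forall k : 'I_m * 'I_n,
    `|L k.1 k.2 - f x k.1 k.2| <= e.
  apply: filter_forall => k; have /cvgrPdist_le := fL k.1 k.2; exact.
apply: filterS fe => x fe; apply: norm_le_entries => [|i j]; first exact: ltW.
by rewrite !mxE; exact: (fe (i, j)).
Qed.

Lemma cvg_entry (R : realType) (m n : nat) (T : Type) (F : set_system T)
    (FF : Filter F) (f : T -> 'M[R]_(m, n)) (L : 'M[R]_(m, n)) i j :
  f x @[x --> F] --> L -> f x i j @[x --> F] --> L i j.
Proof.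
move=> /cvgrPdist_le fL; apply/cvgrPdist_le => e /fL; apply: filterS => x.
by apply: le_trans; have := entry_le_norm (L - f x) i j; rewrite !mxE.
Qed.

Lemma cvg_bigsum (R : realType) (V : normedModType R) (T I : Type)
    (F : set_system T) (FF : Filter F) (r : seq I) (f : I -> T -> V) (L : I -> V) :
  (forall i, f i x @[x --> F] --> L i) ->
  \sum_(i <- r) f i x @[x --> F] --> \sum_(i <- r) L i.
Proof.
move=> fL; apply: (@cvg_big V I _ 0 xpredT) => //; exact: add_continuous.
Qed.

Lemma cvg_mulmx (R : realType) (m n p : nat) (T : Type) (F : set_system T)
    (FF : Filter F) (f : T -> 'M[R]_(m, n)) (g : T -> 'M[R]_(n, p))
    (M : 'M[R]_(m, n)) (N : 'M[R]_(n, p)) :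
  f x @[x --> F] --> M -> g x @[x --> F] --> N ->
  f x *m g x @[x --> F] --> M *m N.
Proof.
move=> fM gN; apply: cvg_mx_entries => i j.
rewrite mxE; under eq_cvg do rewrite mxE.
by apply: cvg_bigsum => k; apply: cvgM; exact: cvg_entry.
Qed.

(** * Right derivatives and the mean value inequality *)

Definition has_rderiv (R : realType) (V : normedModType R) (F : R -> V) (t : R)
    (L : V) : Prop :=
  h^-1 *: (F (t + h) - F t) @[h --> 0^'+] --> L.

Section right_derivatives.
Context (R : realType) (V : normedModType R).
Implicit Types (F G : R -> V) (t : R) (L M : V).

Lemma has_rderivD F G t L M : has_rderiv F t L -> has_rderiv G t M ->
  has_rderiv (fun u => F u + G u) t (L + M).
Proof.
rewrite /has_rderiv => FL GM; under eq_cvg do rewrite opprD addrACA scalerDr.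
exact: cvgD.
Qed.

Lemma has_rderivN F t L : has_rderiv F t L -> has_rderiv (fun u => - F u) t (- L).
Proof.
rewrite /has_rderiv => FL; under eq_cvg do rewrite -opprD scalerN.
exact: cvgN.
Qed.

Lemma has_rderivB F G t L M : has_rderiv F t L -> has_rderiv G t M ->
  has_rderiv (fun u => F u - G u) t (L - M).
Proof. by move=> FL GM; exact/has_rderivD/has_rderivN. Qed.

Lemma has_rderiv_cst L t : has_rderiv (fun=> L) t 0.
Proof.
rewrite /has_rderiv; under eq_cvg do rewrite subrr scaler0; exact: cvg_cst.
Qed.

Lemma has_rderiv_sum (I : Type) (r : seq I) (F : I -> R -> V) t (L : I -> V) :
  (forall i, has_rderiv (F i) t (L i)) ->
  has_rderiv (fun u => \sum_(i <- r) F i u) t (\sum_(i <- r) L i).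
Proof.
rewrite /has_rderiv => FL.
under eq_cvg do rewrite -sumrB scaler_sumr.
exact: cvg_bigsum.
Qed.

Lemma has_rderiv_shift F t c L : has_rderiv F (t + c) L ->
  has_rderiv (fun u => F (u + c)) t L.
Proof. by rewrite /has_rderiv; under eq_cvg do rewrite addrAC. Qed.

(** A right derivative only depends on the germ of the function to the right;
    this is what makes clamped functions differentiable at their corners. *)
Lemma has_rderiv_eq_right F G t L : F t = G t ->
  (\forall h \near 0^'+, F (t + h) = G (t + h)) ->
  has_rderiv F t L -> has_rderiv G t L.
Proof.
move=> FGt FG; apply: cvg_trans; apply: near_eq_cvg.
by move: FG; apply: filterS => h ->; rewrite FGt.
Qed.

Lemma has_rderiv_cvg F t L : has_rderiv F t L -> F (t + h) @[h --> 0^'+] --> F t.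
Proof.
move=> FL; rewrite -[X in _ --> X]addr0 -(scale0r L).
have h0 : (fun h : R => h) @ 0^'+ --> (0 : R).
  exact: (cvg_at_right_filter cvg_id).
have : F t + h *: (h^-1 *: (F (t + h) - F t)) @[h --> 0^'+] --> F t + 0 *: L.
  by apply: cvgD; [exact: cvg_cst|exact: cvgZ].
apply: cvg_trans; apply: near_eq_cvg; near=> h.
have h_neq0 : h != 0 by apply: lt0r_neq0; near: h; exact: nbhs_right_gt.
by rewrite scalerA mulfV// scale1r addrC subrK.
Unshelve. all: by end_near. Qed.

(** Mean value inequality for right derivatives. For a slope e > c the set of
    times up to which the increment is at most e times the elapsed time
    contains its supremum by continuity, and could be prolonged to the right of
    it by the bound on the right derivative; so it reaches b. Then let e tend
    to c. *)
Lemma norm_le_of_has_rderiv F (a b c : R) : a <= b ->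
  (forall t, a <= t -> t <= b -> {for t, continuous F}) ->
  (forall t, a <= t -> t < b -> exists2 L, has_rderiv F t L & `|L| <= c) ->
  `|F b - F a| <= c * (b - a).
Proof.
move=> ab Fcont Fder.
rewrite -lerN2 -subr_ge0 opprK addrC.
(* if the bound failed for c, it would fail for a slope midway between c and
   the actual one *)
suff slope e : c < e -> `|F b - F a| <= e * (b - a).
  rewrite subr_ge0; case: (ltgtP a b) ab => // [ab _|-> _]; last first.
    by rewrite !subrr normr0 mulr0.
  rewrite leNgt; apply/negP => cF.
  have ba0 : 0 < b - a by rewrite subr_gt0.
  pose e := `|F b - F a| / (b - a).
  have ce : c < e by rewrite ltr_pdivlMr.
  have := slope _ (midf_lt ce).1; rewrite -ler_pdivrMr// leNgt.
  by rewrite (midf_lt ce).2.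
move=> ce.
pose S := [set t | a <= t <= b /\
  forall u, a <= u -> u <= t -> `|F u - F a| <= e * (u - a)].
have Sa : S a.
  split; first by rewrite lexx.
  by move=> u au ua; rewrite (@le_anti _ _ u a) ?au ?ua// !subrr normr0 mulr0.
have Sub : ubound S b by move=> t [/andP[]].
have Ssup : has_sup S by split; [exists a|exists b].
set s := sup S.
have as_ : a <= s by exact: sup_upper_bound.
have sb : s <= b by apply: sup_le_ub => //; exists a.
have below u : a <= u -> u < s -> `|F u - F a| <= e * (u - a).
  move=> au us; have su : 0 < s - u by rewrite subr_gt0.
  have [t St ut] := sup_adherent su Ssup.
  by apply: St.2 => //; move: ut; rewrite subKr => /ltW.
have Fs : `|F s - F a| <= e * (s - a).
  move: (as_); rewrite le_eqVlt => /predU1P[<-|{}as_].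
    by rewrite !subrr normr0 mulr0.
  have sF : (fun u => e * (u - a) - `|F u - F a|) @ s^'- --> e * (s - a) - `|F s - F a|.
    apply: cvg_at_left_filter; apply: cvgB.
      by apply: cvgMr; apply: cvgB; [exact: cvg_id|exact: cvg_cst].
    by apply: cvg_norm; apply: cvgB; [exact: Fcont (ltW as_) sb|exact: cvg_cst].
  rewrite -subr_ge0; apply: (cvgr_to_ge sF).
  near=> u; rewrite subr_ge0; apply: below; last by near: u; exact: nbhs_left_lt.
  by apply: ltW; near: u; exact: nbhs_left_gt.
move: sb; rewrite le_eqVlt => /predU1P[<- //|sb].
have [L FL Lc] := Fder _ as_ sb.
have : \forall h \near 0^'+, `|h^-1 *: (F (s + h) - F s)| <= e.
  have /cvgr_norm_le : `|L| < e by exact: le_lt_trans ce.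
  exact.
move=> -[d /= d0 dF].
have {}dF u : s < u -> u < s + d -> `|F u - F s| <= e * (u - s).
  move=> su usd; have us0 : 0 < u - s by rewrite subr_gt0.
  have := dF (u - s); rewrite /ball_/= sub0r normrN gtr0_norm// ltrBlDl.
  move=> /(_ usd us0); rewrite (addrC s) subrK normrZ gtr0_norm ?invr_gt0//.
  by rewrite ler_pdivrMl// mulrC.
pose r := Num.min (s + d / 2) b.
have sr : s < r by rewrite lt_min sb ltrDl divr_gt0.
suff : S r by move/(ub_le_sup (ex_intro _ b Sub)); rewrite leNgt sr.
split; first by rewrite (le_trans as_ (ltW sr)) ge_min lexx orbT.
move=> u au ur; case: (ltgtP u s) => [us|su|->//]; first exact: below.
have usd : u < s + d.
  apply: le_lt_trans ur _; rewrite gt_min ltrD2l; apply/orP; left.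
  by rewrite ltr_pdivrMr// ltr_pMr// ltr1n.
rewrite (_ : F u - F a = (F u - F s) + (F s - F a)); last by rewrite subrKA.
rewrite (le_trans (ler_normD _ _))//.
have -> : e * (u - a) = e * (u - s) + e * (s - a) by ring.
by rewrite lerD// dF.
Unshelve. all: by end_near. Qed.
End right_derivatives.

(** * Products, time reversal, clamping and antiderivatives *)

Lemma has_rderiv_mulmx (R : realType) (m n p : nat) (F : R -> 'M[R]_(m, n))
    (G : R -> 'M[R]_(n, p)) (t : R) (L : 'M[R]_(m, n)) (M : 'M[R]_(n, p)) :
  has_rderiv F t L -> has_rderiv G t M ->
  has_rderiv (fun u => F u *m G u) t (L *m G t + F t *m M).
Proof.
move=> FL GM; rewrite /has_rderiv.
have -> : (fun h => h^-1 *: (F (t + h) *m G (t + h) - F t *m G t)) =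
    fun h => (h^-1 *: (F (t + h) - F t)) *m G (t + h) +
             F t *m (h^-1 *: (G (t + h) - G t)).
  apply/funext => h; rewrite -scalemxAl -scalemxAr -scalerDr; congr (_ *: _).
  by rewrite mulmxBl mulmxBr subrKA.
apply: cvgD; apply: cvg_mulmx => //; [exact: has_rderiv_cvg GM|exact: cvg_cst].
Qed.

Lemma has_rderiv_mulmxl (R : realType) (m n p : nat) (M : 'M[R]_(m, n))
    (G : R -> 'M[R]_(n, p)) (t : R) (L : 'M[R]_(n, p)) :
  has_rderiv G t L -> has_rderiv (fun u => M *m G u) t (M *m L).
Proof.
by move=> /(has_rderiv_mulmx (has_rderiv_cst M t)); rewrite mul0mx add0r.
Qed.

Lemma has_rderiv_mulmxr (R : realType) (m n p : nat) (M : 'M[R]_(n, p))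
    (G : R -> 'M[R]_(m, n)) (t : R) (L : 'M[R]_(m, n)) :
  has_rderiv G t L -> has_rderiv (fun u => G u *m M) t (L *m M).
Proof.
by move=> /has_rderiv_mulmx/(_ (has_rderiv_cst M t)); rewrite mulmx0 addr0.
Qed.

(** The two-sided notion is the one that survives time reversal; antiderivatives
    of continuous functions have it. *)
Definition has_deriv (R : realType) (V : normedModType R) (F : R -> V) (t : R)
    (L : V) : Prop :=
  h^-1 *: (F (t + h) - F t) @[h --> 0^'] --> L.

Section two_sided_derivatives.
Context (R : realType) (V : normedModType R).
Implicit Types (F G : R -> V) (t : R) (L : V).

Lemma has_derivable1 (f : R -> R) t : derivable f t 1 -> has_deriv f t (derive1 f t).
Proof.
rewrite derive1E /has_deriv => df.
have <- : (fun h : R => h^-1 *: ((f \o shift t) (h *: 1) - f t)) =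
          (fun h => h^-1 *: (f (t + h) - f t)).
  by apply/funext => h /=; rewrite [_ *: 1]mulr1 (addrC h).
exact: df.
Qed.

Lemma has_deriv_has_rderiv F t L : has_deriv F t L -> has_rderiv F t L.
Proof. exact: cvg_dnbhs_at_right. Qed.

Lemma has_deriv_continuous F t L : has_deriv F t L -> {for t, continuous F}.
Proof.
move=> FL.
have F0 : F (t + h) @[h --> 0^'] --> F t.
  rewrite -[X in _ --> X]addr0 -(scale0r L).
  have h0 : (fun h : R => h) @ 0^' --> (0 : R) by exact: nbhs_dnbhs.
  have : F t + h *: (h^-1 *: (F (t + h) - F t)) @[h --> 0^'] --> F t + 0 *: L.
    by apply: cvgD; [exact: cvg_cst|exact: cvgZ].
  apply: cvg_trans; apply: near_eq_cvg; near=> h.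
  have h_neq0 : h != 0 by near: h; exact: nbhs_dnbhs_neq.
  by rewrite scalerA mulfV// scale1r addrC subrK.
apply/continuous_withinNx/cvgrPdist_le => e.
move/cvgrPdist_le : F0 => /[apply] -[d /= d0 dF].
exists d => // u; rewrite /ball_/= distrC => ud ut.
have := dF (u - t); rewrite /ball_/= sub0r normrN subr_eq0 => /(_ ud ut).
by rewrite [t + _]addrC subrK.
Unshelve. all: by end_near. Qed.

Lemma has_deriv_reflect F (c t : R) L : has_deriv F (c - t) L ->
  has_deriv (fun u => F (c - u)) t (- L).
Proof.
move=> /cvgrPdist_le FL; apply/cvgrPdist_le => e /FL [d /= d0 dF].
exists d => // h; rewrite /ball_/= sub0r normrN => hd h0.
have := dF (- h); rewrite /ball_/= sub0r opprK oppr_eq0 => /(_ hd h0).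
by rewrite invrN scaleNr opprK -opprD normrN [in X in _ -> X]opprD addrA.
Qed.

(** Stopping F at time b. At t = b the stopped function is already constant to
    the right, hence the strict inequality. *)
Lemma has_rderiv_clamp_above F (b t : R) L : (t < b -> has_rderiv F t L) ->
  has_rderiv (fun u => F (Num.min u b)) t (if t < b then L else 0).
Proof.
case: ltP => [tb /(_ isT)|bt _].
  apply: has_rderiv_eq_right; first by rewrite min_l// ltW.
  near=> h; rewrite min_l// -lerBrDl.
  by near: h; apply: nbhs_right_ltW; rewrite subr_gt0.
apply: (has_rderiv_eq_right _ _ (has_rderiv_cst (F b) t)).
  by rewrite min_r.
by near=> h; rewrite min_r// ler_wpDr.
Unshelve. all: by end_near. Qed.

(** Freezing F before time a. At t = a the clamped function already follows F to
    the right, hence the weak inequality. *)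
Lemma has_rderiv_clamp_below F (a t : R) L : (a <= t -> has_rderiv F t L) ->
  has_rderiv (fun u => F (Num.max a u)) t (if a <= t then L else 0).
Proof.
case: leP => [at_ /(_ isT)|ta _].
  apply: has_rderiv_eq_right; first by rewrite max_r.
  by near=> h; rewrite max_r// ler_wpDr.
apply: (has_rderiv_eq_right _ _ (has_rderiv_cst (F a) t)).
  by rewrite max_l// ltW.
near=> h; rewrite max_l// -lerBrDl.
by near: h; apply: nbhs_right_ltW; rewrite subr_gt0.
Unshelve. all: by end_near. Qed.
End two_sided_derivatives.

(** The integral is started at a - 1, so that the derivative is two-sided at a
    as well, and then normalised to vanish at a. *)
Lemma continuous_antiderivative (R : realType) (f : R -> R) (a : R) :
  continuous f ->
  exists F : R -> R, [/\ forall t, a - 1 < t -> has_deriv F t (f t), F a = 0 &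
    forall t, a <= t -> \int[@lebesgue_measure R]_(s in `[a, t]) f s = F t].
Proof.
move=> fc.
have fi x y : (@lebesgue_measure R).-integrable `[x, y] (EFin \o f).
  apply: continuous_compact_integrable; first exact: segment_compact.
  exact: continuous_subspaceT.
pose F0 x := \int[@lebesgue_measure R]_(s in `[a - 1, x]) f s.
have a1 : a - 1 <= a by rewrite gerBl.
exists (fun x => F0 x - F0 a); split => [t t1||t at_]; last 2 first.
- by rewrite subrr.
- rewrite -Rintegral_itv_obnd_cbnd; last first.
    by apply: integrableS (fi a t) => //; exact: subset_itv_oc_cc.
  by rewrite -(@Rintegral_itvB _ f (BLeft (a - 1)) (BRight t) a)// bnd_simp.
have [dF F'] := @continuous_FTC1_closed _ f (a - 1) t (t + 1)
  (ltac:(by rewrite ltrDl)) (fi _ _) t1 (fc t).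
rewrite /has_deriv; under eq_cvg do rewrite opprB addrA subrK.
by rewrite -F'; exact: has_derivable1.
Qed.

Lemma mx_antiderivative (R : realType) (m n : nat) (F : R -> 'M[R]_(m, n))
    (a : R) :
  continuous F ->
  exists G : R -> 'M[R]_(m, n),
    [/\ forall t, a - 1 < t -> has_deriv G t (F t), G a = 0 &
    forall t i j, a <= t ->
      \int[@lebesgue_measure R]_(s in `[a, t]) F s i j = G t i j].
Proof.
move=> Fc.
have Fcij i j : continuous (fun t => F t i j) by move=> t; apply: cvg_entry; exact: Fc.
pose G i j := sval (cid (@continuous_antiderivative _ (fun t => F t i j) a (Fcij i j))).
have GP i j := svalP (cid (@continuous_antiderivative _ (fun t => F t i j) a (Fcij i j))).
exists (fun t => \matrix_(i, j) G i j t); split => [t at_||t i j at_].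
- apply: cvg_mx_entries => i j; under eq_cvg do rewrite !mxE.
  by have [+ _ _] := GP i j; exact.
- by apply/matrixP => i j; rewrite !mxE; have [] := GP i j.
- by rewrite mxE; have [_ _ ->] := GP i j.
Qed.

(** * Delay operators and uniqueness *)

Section delay_operators.
Context (R : realType) (n m : nat) (A0 : 'M[R]_n) (A : 'I_m -> 'M[R]_n)
  (tau : 'I_m -> R).
Implicit Types (F G : R -> 'M[R]_n) (t : R).

Definition delay_left F t : 'M[R]_n :=
  A0 *m F t + \sum_(j < m) A j *m F (t - tau j).

Definition delay_right F t : 'M[R]_n :=
  F t *m A0 + \sum_(j < m) F (t - tau j) *m A j.

Lemma delay_leftD F G t :
  delay_left (fun u => F u + G u) t = delay_left F t + delay_left G t.
Proof.
rewrite /delay_left mulmxDr addrACA -big_split; congr (_ + _).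
by apply: eq_bigr => j _; rewrite mulmxDr.
Qed.

Lemma delay_leftN F t : delay_left (fun u => - F u) t = - delay_left F t.
Proof.
rewrite /delay_left mulmxN opprD -sumrN; congr (_ + _).
by apply: eq_bigr => j _; rewrite mulmxN.
Qed.

Lemma delay_rightD F G t :
  delay_right (fun u => F u + G u) t = delay_right F t + delay_right G t.
Proof.
rewrite /delay_right mulmxDl addrACA -big_split; congr (_ + _).
by apply: eq_bigr => j _; rewrite mulmxDl.
Qed.

(** Left and right multiplications commute, and so do translations in time. *)
Lemma delay_left_right F t :
  delay_left (delay_right F) t = delay_right (delay_left F) t.
Proof.
have L j : A j *m delay_right F (t - tau j) = A j *m F (t - tau j) *m A0 +
    \sum_(k < m) A j *m F (t - tau j - tau k) *m A k.
  by rewrite mulmxDr mulmxA mulmx_sumr; under eq_bigr do rewrite mulmxA.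
have L' j : delay_left F (t - tau j) *m A j = A0 *m F (t - tau j) *m A j +
    \sum_(k < m) A k *m F (t - tau j - tau k) *m A j.
  by rewrite mulmxDl mulmx_suml.
rewrite [LHS]/delay_left [RHS]/delay_right (eq_bigr _ (fun j _ => L j)).
rewrite [in RHS](eq_bigr _ (fun j _ => L' j)) !big_split /= exchange_big /=.
rewrite /delay_left /delay_right mulmxDr mulmxDl mulmx_sumr mulmx_suml.
rewrite mulmxA addrACA; congr (_ + _ + (_ + _)).
  by apply: eq_bigr => j _; rewrite mulmxA.
apply: eq_bigr => j _; apply: eq_bigr => k _.
by rewrite addrAC.
Qed.

Lemma delay_left_continuous F : continuous F -> continuous (delay_left F).
Proof.
move=> Fc t; apply: cvgD.
  by apply: cvg_mulmx; [exact: cvg_cst|exact: Fc].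
apply: cvg_bigsum => j; apply: cvg_mulmx; first exact: cvg_cst.
apply: (@cvg_comp _ _ _ (fun u => u - tau j) F _ _ _ _ (Fc (t - tau j))).
by apply: cvgB; [exact: cvg_id|exact: cvg_cst].
Qed.

Lemma delay_right_continuous F : continuous F -> continuous (delay_right F).
Proof.
move=> Fc t; apply: cvgD.
  by apply: cvg_mulmx; [exact: Fc|exact: cvg_cst].
apply: cvg_bigsum => j; apply: cvg_mulmx; last exact: cvg_cst.
apply: (@cvg_comp _ _ _ (fun u => u - tau j) F _ _ _ _ (Fc (t - tau j))).
by apply: cvgB; [exact: cvg_id|exact: cvg_cst].
Qed.

Lemma has_rderiv_delay_left F G t : (forall u, has_rderiv F u (G u)) ->
  has_rderiv (delay_left F) t (delay_left G t).
Proof.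
move=> FG; apply: has_rderivD; first exact: has_rderiv_mulmxl.
by apply: has_rderiv_sum => j; apply/has_rderiv_mulmxl/has_rderiv_shift.
Qed.

Lemma has_rderiv_delay_right F G t : (forall u, has_rderiv F u (G u)) ->
  has_rderiv (delay_right F) t (delay_right G t).
Proof.
move=> FG; apply: has_rderivD; first exact: has_rderiv_mulmxr.
by apply: has_rderiv_sum => j; apply/has_rderiv_mulmxr/has_rderiv_shift.
Qed.

(** A solution of the delay equation with zero past vanishes. If it vanishes up
    to time a, then over a window of length d to the right of a its maximum w is
    at most c d w, where c bounds the coefficients; d is chosen such that
    c d <= 1/2, so w = 0, and windows of the fixed length d cover the
    half-line. *)
Lemma delay_solution_eq0 F : (forall j, 0 < tau j) -> continuous F ->
  (forall t, t <= 0 -> F t = 0) ->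
  (forall t, 0 <= t -> has_rderiv F t (delay_left F t)) ->
  forall t, F t = 0.
Proof.
move=> tau0 Fc F0 FD.
pose c : R := n%:R * `|A0| + \sum_(j < m) n%:R * `|A j|.
have c0 : 0 <= c by rewrite addr_ge0 ?mulr_ge0 ?sumr_ge0// => j _; rewrite mulr_ge0.
have lopc t w : 0 <= w -> (forall u, u <= t -> `|F u| <= w) ->
    `|delay_left F t| <= c * w.
  move=> w0 Fw; rewrite /c mulrDl mulr_suml.
  apply: le_trans (ler_normD _ _) _; apply: lerD.
    by apply: le_trans (norm_mulmx_le _ _) _; rewrite ler_wpM2l ?mulr_ge0// Fw.
  apply: le_trans (ler_norm_sum _ _ _) _; apply: ler_sum => j _.
  apply: le_trans (norm_mulmx_le _ _) _; rewrite ler_wpM2l ?mulr_ge0// Fw//.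
  by rewrite gerBl ltW.
pose d := (2 * (c + 1))^-1.
have c1 : 0 < c + 1 by rewrite ltr_wpDl.
have d0 : 0 < d by rewrite invr_gt0 mulr_gt0.
have cd : c * d <= 2^-1.
  by rewrite /d invfM mulrCA ler_piMr// ler_pdivrMr// mul1r lerDl.
have step k : forall t, t <= k%:R * d -> F t = 0.
  elim: k => [|k IH]; first by rewrite mul0r.
  set a := k%:R * d in IH.
  have a0 : 0 <= a by rewrite mulr_ge0// ltW.
  have ak : a <= k.+1%:R * d by rewrite ler_wpM2r ?ler_nat// ltW.
  have [//|s] := @EVT_max R (fun t => `|F t|) a (k.+1%:R * d) ak.
    by apply: continuous_subspaceT => t; apply: cvg_norm; exact: Fc.
  rewrite in_itv/= => /andP[as_ sk] smax.
  have Fs u : u <= k.+1%:R * d -> `|F u| <= `|F s|.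
    move=> uk; have [au|/ltW/IH ->] := leP a u; last by rewrite normr0.
    by apply: smax; rewrite in_itv/= au.
  suff F0s : `|F s| <= 0.
    by move=> t tk; apply/eqP; rewrite -normr_le0 (le_trans (Fs _ tk)).
  have : `|F s - F a| <= c * `|F s| * (s - a).
    apply: norm_le_of_has_rderiv => // [t _ _|t at_ ts]; first exact: Fc.
    exists (delay_left F t).
      by apply: FD; exact: le_trans at_.
    by apply: lopc => // u ut; apply: Fs; rewrite (le_trans ut)// (le_trans (ltW ts)).
  rewrite (IH a)// subr0 => Fle.
  have sad : s - a <= d.
    by rewrite lerBlDr (le_trans sk)// -natr1 mulrDl mul1r addrC.
  have : `|F s| <= 2^-1 * `|F s|.
    apply: le_trans Fle _; rewrite mulrAC ler_wpM2r//.
    by apply: le_trans cd; rewrite ler_wpM2l.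
  by lra.
move=> t; apply: (step (Num.truncn (t / d)).+1).
by rewrite -ler_pdivrMr// ltW// truncnS_gt.
Qed.
End delay_operators.

(** * The fundamental matrix and its primitive *)

Section fundamental_matrix.
Context (R : realType) (n m : nat) (A0 : 'M[R]_n) (A : 'I_m -> 'M[R]_n)
  (tau : 'I_m -> R) (X : R -> 'M[R]_n).
Hypothesis hX : is_fundamental_matrix A0 A tau X.

Lemma max0_continuous : continuous (Num.max (0 : R)).
Proof.
by move=> t; apply: (@continuous_max R R (cst 0) id t); [exact: cst_continuous|].
Qed.

(** X jumps at 0; replacing its past by the value at 0 removes the jump. *)
Lemma fundamental_matrix_clamp_continuous :
  continuous (fun t : R => X (Num.max 0 t)).
Proof.
have [/subspace_continuousP Xc _ _ _] := hX.
move=> t.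
have m0 : 0 <= Num.max 0 t by rewrite le_max lexx.
apply: (@cvg_comp _ _ _ (Num.max 0) X _ _ _ _ (Xc (Num.max 0 t) _)); last by rewrite /= in_itv/= m0.
move=> P /(@max0_continuous t); apply: (@filterS _ (nbhs t)) => u; apply.
by rewrite /= in_itv/= le_max lexx.
Qed.

(** The integral of X over [0, t] is everywhere differentiable from the right,
    with derivative X, because X is continuous from the right at its jump. Run
    backwards in time it sees the left limit of X instead, which is 0 at the
    jump; hence the strict inequality in the fourth clause. *)
Lemma fundamental_matrix_primitive :
  exists P : R -> 'M[R]_n, [/\ continuous P, forall t, t <= 0 -> P t = 0,
    forall t, has_rderiv P t (X t),
    forall c t, has_rderiv (fun u => P (c - u)) t
                  (- (if t < c then X (c - t) else 0)) &
    forall t i j, 0 <= t ->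
      \int[@lebesgue_measure R]_(s in `[0, t]) X s i j = P t i j].
Proof.
have [_ _ X0 _] := hX.
have [Phi [Phid Phi0 Phiint]] :=
  mx_antiderivative 0 fundamental_matrix_clamp_continuous.
have maxN1 (t : R) : 0 - 1 < Num.max 0 t by rewrite lt_max sub0r ltrN10.
exists (fun t => Phi (Num.max 0 t)); split => [t|t t0|t|c t|t i j t0].
- apply: (@cvg_comp _ _ _ (Num.max 0) Phi _ _ _ _
    (has_deriv_continuous (Phid _ (maxN1 t)))).
  exact: max0_continuous.
- by rewrite max_l.
- (* the shape produced by clamping from below *)
  have -> : X t = if 0 <= t then X (Num.max 0 t) else 0.
    by case: leP => [//|/X0 ->].
  apply: has_rderiv_clamp_below => t0.
  by apply/has_deriv_has_rderiv/Phid; rewrite (lt_le_trans _ t0)// sub0r ltrN10.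
- have -> : (fun u => Phi (Num.max 0 (c - u))) = (fun u => Phi (c - Num.min u c)).
    apply/funext => u; congr Phi.
    have [uc|cu] := leP u c; first by rewrite max_r// subr_ge0.
    by rewrite subrr max_l// subr_le0 ltW.
  have -> : - (if t < c then X (c - t) else 0) =
            if t < c then - X (Num.max 0 (c - t)) else 0.
    by case: ltP => tc; rewrite ?oppr0// max_r// subr_ge0 ltW.
  apply: (@has_rderiv_clamp_above _ _ (fun u => Phi (c - u))) => tc.
  apply/has_deriv_has_rderiv/has_deriv_reflect/Phid.
  by rewrite (lt_trans _ (_ : 0 < _)) ?subr_gt0// sub0r ltrN10.
- rewrite max_r// -Phiint//; apply: eq_Rintegral => s; rewrite inE/= in_itv/=.
  by case/andP => s0 _; rewrite max_r.
Qed.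

End fundamental_matrix.

(** * The adjoint equation and variation of constants *)

Section adjoint_equation.
Context (R : realType) (n m : nat) (A0 : 'M[R]_n) (A : 'I_m -> 'M[R]_n)
  (tau : 'I_m -> R) (X : R -> 'M[R]_n).
Hypothesis tau_gt0 : forall j, 0 < tau j.
Hypothesis hX : is_fundamental_matrix A0 A tau X.
Context (P : R -> 'M[R]_n).
Hypothesis P_continuous : continuous P.
Hypothesis P_past : forall t, t <= 0 -> P t = 0.
Hypothesis P_rderiv : forall t, has_rderiv P t (X t).
Hypothesis P_reflect : forall c t, has_rderiv (fun u => P (c - u)) t
  (- (if t < c then X (c - t) else 0)).

Let X_past t : t < 0 -> X t = 0. Proof. by have [_ _ + _] := hX; exact. Qed.

Let X_at0 : X 0 = 1%:M. Proof. by have [_ _ _] := hX. Qed.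

Let X_clamp_rderiv t : 0 <= t ->
  has_rderiv (fun u => X (Num.max 0 u)) t (delay_left A0 A tau X t).
Proof.
move=> t0; have [_ /(_ _ t0) Xt _ _] := hX.
by have := @has_rderiv_clamp_below _ _ X 0 t _ (fun _ => Xt); rewrite t0.
Qed.

Definition heaviside (t : R) : 'M[R]_n := if 0 <= t then 1%:M else 0.

Lemma delay_left_past t : t <= 0 -> delay_left A0 A tau P t = 0.
Proof.
move=> t0; rewrite /delay_left P_past// mulmx0 add0r big1// => j _.
by rewrite P_past ?mulmx0// subr_le0 (le_trans t0)// ltW.
Qed.

Lemma delay_right_past t : t <= 0 -> delay_right A0 A tau P t = 0.
Proof.
move=> t0; rewrite /delay_right P_past// mul0mx add0r big1// => j _.
by rewrite P_past ?mul0mx// subr_le0 (le_trans t0)// ltW.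
Qed.

(** The fundamental matrix solves the equation with a unit impulse at time 0;
    this is its integrated form, valid on the whole line. *)
Lemma fundamental_matrix_integrated t :
  X t = heaviside t + delay_left A0 A tau P t.
Proof.
rewrite /heaviside; case: leP => t0; last first.
  by rewrite X_past// delay_left_past ?addr0// ltW.
pose D u := X (Num.max 0 u) - delay_left A0 A tau P u.
have : `|D t - D 0| <= 0 * (t - 0).
  apply: norm_le_of_has_rderiv => // [u _ _|u u0 _].
    apply: cvgB; first exact: (fundamental_matrix_clamp_continuous hX).
    exact: delay_left_continuous.
  exists 0; last by rewrite normr0.
  rewrite -(subrr (delay_left A0 A tau X u)).
  by apply: has_rderivB; [exact: X_clamp_rderiv|exact: has_rderiv_delay_left].
rewrite mul0r normr_le0 /D (delay_left_past (lexx 0)) (max_r t0) maxxx X_at0 subr0.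
by rewrite subr_eq0 => /eqP <-; rewrite subrK.
Qed.

(** The difference E of both sides has derivative delay_left X - delay_right X.
    Substituting the integrated equation for X, the impulse terms cancel
    because the step function takes scalar matrices as values, and the
    commutation of the two operators turns the rest into delay_left E. So E
    solves the delay equation with zero past. *)
Lemma delay_left_right_primitive t :
  delay_left A0 A tau P t = delay_right A0 A tau P t.
Proof.
apply/eqP; rewrite -subr_eq0; apply/eqP; move: t.
apply: (delay_solution_eq0 (A0 := A0) (A := A) (tau := tau)) => // [u|u u0|u _].
- by apply: cvgB; [exact: delay_left_continuous|exact: delay_right_continuous].
- by rewrite delay_left_past// delay_right_past// subr0.
rewrite delay_leftD delay_leftN delay_left_right.
have -> : delay_left A0 A tau (delay_left A0 A tau P) u -
    delay_right A0 A tau (delay_left A0 A tau P) u =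
    delay_left A0 A tau X u - delay_right A0 A tau X u.
  rewrite (funext fundamental_matrix_integrated) delay_leftD delay_rightD.
  have -> : delay_left A0 A tau heaviside u = delay_right A0 A tau heaviside u.
    rewrite /delay_left /delay_right /heaviside; congr (_ + _).
      by case: ifP => _; rewrite ?mulmx1 ?mul1mx ?mulmx0 ?mul0mx.
    apply: eq_bigr => j _.
    by case: ifP => _; rewrite ?mulmx1 ?mul1mx ?mulmx0 ?mul0mx.
  move: (delay_right _ _ _ heaviside u) (delay_left _ _ _ _ u) => H L.
  by move: (delay_right _ _ _ _ u) => M; rewrite opprD addrACA subrr add0r.
by apply: has_rderivB; [exact: has_rderiv_delay_left|exact: has_rderiv_delay_right].
Qed.

(** The adjoint equation, run backwards in time. As X itself need not have a left
    derivative known in advance, X(t - .) is rewritten as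
    I + delay_right P (t - .), where the reflected P is differentiable from the
    right. *)
Let X_reflect_rderiv t u : u < t ->
  has_rderiv (fun v => X (Num.max 0 (t - v))) u
    (- (X (t - u) *m A0 +
        \sum_(j < m) (if u + tau j < t then X (t - (u + tau j)) else 0) *m A j)).
Proof.
move=> ut.
have XE v : v <= t -> X (Num.max 0 (t - v)) = 1%:M + delay_right A0 A tau P (t - v).
  move=> vt; rewrite max_r ?subr_ge0// fundamental_matrix_integrated.
  by rewrite /heaviside subr_ge0 vt delay_left_right_primitive.
apply: (has_rderiv_eq_right (F := fun v => 1%:M + delay_right A0 A tau P (t - v))).
- by rewrite XE// ltW.
- near=> h; rewrite XE// -lerBrDl.
  by near: h; apply: nbhs_right_ltW; rewrite subr_gt0.
rewrite -[X in has_rderiv _ _ X]add0r.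
apply: has_rderivD; first exact: has_rderiv_cst.
rewrite opprD -sumrN -mulNmx; apply: has_rderivD.
  by apply: has_rderiv_mulmxr; have := @P_reflect t u; rewrite ut.
apply: has_rderiv_sum => j; rewrite -mulNmx; apply: has_rderiv_mulmxr.
have := @P_reflect (t - tau j) u; rewrite ltrBrDr -addrA -opprD (addrC (tau j)).
by under [X in has_rderiv X]eq_fun do rewrite addrAC.
Unshelve. all: by end_near. Qed.

(** Variation of constants; J j is an antiderivative of the j-th integrand. The
    derivative of u |-> X(t - u) X(s + u) is the sum over j of
    K j u - K j (u + tau j), with K j cut off after time t, where X(t - .) is
    zero. Adding the integrals of K j over [u, u + tau j], cut off in the same
    way, gives a function Q of derivative zero, and the formula is Q t = Q 0. *)
Lemma fundamental_matrix_variation_of_constants (h t s : R) :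
  0 <= h -> (forall j, tau j <= h) -> h <= t -> h <= s ->
  exists J : 'I_m -> R -> 'M[R]_n, [/\ forall j, J j 0 = 0,
    forall j v, 0 <= v -> v <= tau j ->
      has_deriv (J j) v (X (t - v) *m A j *m X (v + s - tau j)) &
    X (t + s) = X t *m X s + \sum_(j < m) J j (tau j)].
Proof.
move=> h0 tauh ht hs.
have t0 : 0 <= t by exact: le_trans ht.
have s0 : 0 <= s by exact: le_trans hs.
have Xc := fundamental_matrix_clamp_continuous hX.
pose K j v := X (Num.max 0 (t - v)) *m A j *m X (Num.max 0 (v + s - tau j)).
have Kc j : continuous (K j).
  move=> v; apply: cvg_mulmx; first (apply: cvg_mulmx; last exact: cvg_cst).
    apply: (@cvg_comp _ _ _ (fun v => t - v) (fun v => X (Num.max 0 v))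
      _ _ _ _ (Xc (t - v))).
    by apply: cvgB; [exact: cvg_cst|exact: cvg_id].
  apply: (@cvg_comp _ _ _ (fun v => v + s - tau j) (fun v => X (Num.max 0 v))
    _ _ _ _ (Xc (v + s - tau j))).
  apply: cvgB; last exact: cvg_cst.
  by apply: cvgD; [exact: cvg_id|exact: cvg_cst].
pose J j := sval (cid (mx_antiderivative 0 (Kc j))).
have JP j : [/\ forall v, 0 - 1 < v -> has_deriv (J j) v (K j v), J j 0 = 0 & _] :=
  svalP (cid (mx_antiderivative 0 (Kc j))).
have Jd j v : 0 <= v -> has_deriv (J j) v (K j v).
  move=> v0; have [+ _ _] := JP j; apply.
  by rewrite sub0r (lt_le_trans _ v0)// ltrN10.
exists J; split=> [j|j v v0 vj|]; first by have [] := JP j.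
  have tv : 0 <= t - v by rewrite subr_ge0 (le_trans vj)// (le_trans (tauh j)).
  have vs : 0 <= v + s - tau j by rewrite subr_ge0 ler_wpDl// (le_trans (tauh j)).
  by have := Jd j v v0; rewrite /K (max_r tv) (max_r vs).
pose Q u := X (Num.max 0 (t - u)) *m X (Num.max 0 (u + s)) +
  \sum_(j < m) (J j (Num.min (u + tau j) t) - J j (Num.min u t)).
suff QE : Q t = Q 0.
  have Qt : Q t = X (t + s).
    rewrite /Q subrr maxxx X_at0 mul1mx max_r ?addr_ge0// big1 ?addr0// => j _.
    by rewrite minxx min_r ?subrr// lerDl ltW.
  rewrite -Qt QE /Q subr0 add0r !max_r//; congr (_ + _).
  apply: eq_bigr => j _; rewrite add0r min_l ?(le_trans (tauh j))//.
  by rewrite min_l//; have [_ -> _] := JP j; rewrite subr0.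
suff : `|Q t - Q 0| <= 0 * (t - 0).
  by rewrite mul0r normr_le0 subr_eq0 => /eqP.
apply: norm_le_of_has_rderiv => // [u u0 ut|u u0 ut].
  apply: cvgD.
    apply: cvg_mulmx.
      apply: (@cvg_comp _ _ _ (fun v => t - v) (fun v => X (Num.max 0 v))
        _ _ _ _ (Xc (t - u))).
      by apply: cvgB; [exact: cvg_cst|exact: cvg_id].
    apply: (@cvg_comp _ _ _ (fun v => v + s) (fun v => X (Num.max 0 v))
      _ _ _ _ (Xc (u + s))).
    by apply: cvgD; [exact: cvg_id|exact: cvg_cst].
  have Jmin j c : 0 <= c -> {for u, continuous (fun v : R => J j (Num.min (v + c) t))}.
    move=> c0.
    have uc0 : 0 <= Num.min (u + c) t by rewrite le_min t0 addr_ge0.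
    apply: (@cvg_comp _ _ _ (fun v => Num.min (v + c) t) (J j)
      _ _ _ _ (has_deriv_continuous (Jd j _ uc0))).
    apply: (@continuous_min R R (fun v => v + c) (cst t) u); last exact: cst_continuous.
    by apply: cvgD; [exact: cvg_id|exact: cvg_cst].
  apply: cvg_bigsum => j; apply: cvgB; first exact/Jmin/ltW.
  have := Jmin j 0 (lexx 0).
  rewrite (_ : (fun v : R => _) = (fun v : R => J j (Num.min v t))) //.
  by apply/funext => v; rewrite addr0.
exists 0; last by rewrite normr0.
(* the left limit of X at t - (u + r), for r > 0 *)
pose X' r : 'M[R]_n := if u + r < t then X (t - (u + r)) else 0.
have -> : 0 = - (X (t - u) *m A0 + \sum_(j < m) X' (tau j) *m A j) *m X (u + s) +
    X (t - u) *m delay_left A0 A tau X (u + s) +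
    \sum_(j < m) ((if u + tau j < t then K j (u + tau j) else 0) - K j u).
  rewrite /delay_left mulNmx mulmxDl mulmxDr mulmxA mulmx_suml mulmx_sumr sumrB.
  have -> : \sum_(j < m) (if u + tau j < t then K j (u + tau j) else 0) =
      \sum_(j < m) X' (tau j) *m A j *m X (u + s).
    apply: eq_bigr => j _; rewrite /X'; case: ifP => uj; last by rewrite !mul0mx.
    have tv : 0 <= t - (u + tau j) by rewrite subr_ge0 ltW.
    have vs : u + tau j + s - tau j = u + s by rewrite addrAC addrK.
    by rewrite /K vs (max_r tv) (max_r (addr_ge0 u0 s0)).
  have -> : \sum_(j < m) K j u = \sum_(j < m) X (t - u) *m (A j *m X (u + s - tau j)).
    apply: eq_bigr => j _.
    have tu : 0 <= t - u by rewrite subr_ge0 ltW.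
    have us : 0 <= u + s - tau j by rewrite subr_ge0 ler_wpDl// (le_trans (tauh j)).
    by rewrite /K mulmxA (max_r tu) (max_r us).
  by rewrite opprD addrACA subrK addrK addNr.
apply: has_rderivD.
  have tu : 0 <= t - u by rewrite subr_ge0 ltW.
  have := has_rderiv_mulmx (X_reflect_rderiv ut)
    (has_rderiv_shift (X_clamp_rderiv (addr_ge0 u0 s0))).
  by rewrite (max_r tu) (max_r (addr_ge0 u0 s0)).
apply: has_rderiv_sum => j; apply: has_rderivB.
  apply: (@has_rderiv_shift _ _ (fun v => J j (Num.min v t))).
  apply: has_rderiv_clamp_above => _; apply/has_deriv_has_rderiv/Jd.
  by rewrite addr_ge0// ltW.
have := @has_rderiv_clamp_above _ _ (J j) t u (K j u).
by rewrite ut; apply => _; exact/has_deriv_has_rderiv/Jd.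
Qed.

End adjoint_equation.

(** * From convergence to zero to exponential decay *)

(** After k halvings the bound is M / 2 ^ k. The factor 2 pays for rounding t / L
    down to the integer k. *)
Lemma exp_decay_of_halving (R : realType) (f : R -> R) (L M : R) : 0 < L ->
  0 <= M -> (forall t, 0 <= t -> f t <= M) ->
  (forall s c, 0 <= s -> 0 <= c -> (forall t, s <= t -> f t <= c) ->
    forall t, s + L <= t -> f t <= c / 2) ->
  exists2 alpha, 0 < alpha & forall t, 0 <= t -> f t <= M * 2 * expR (- alpha * t).
Proof.
move=> L0 M0 fM fhalf.
have fk k t : k%:R * L <= t -> f t <= M / 2 ^+ k.
  elim: k t => [|k IH] t; first by rewrite mul0r expr0 divr1; exact: fM.
  move=> kt; rewrite exprSr invfM mulrA.
  apply: (fhalf (k%:R * L)); first by rewrite mulr_ge0// ltW.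
  - by rewrite divr_ge0// exprn_ge0.
  - exact: IH.
  - by move: kt; rewrite -natr1 mulrDl mul1r.
have ln2 : 0 < ln 2 :> R by rewrite ln_gt0// ltr1n.
exists (ln 2 / L); first by rewrite divr_gt0.
move=> t t0; set k := Num.truncn (t / L).
have tL : 0 <= t / L by rewrite divr_ge0// ltW.
have kt : k%:R * L <= t.
  by rewrite -ler_pdivlMr// truncn_le.
apply: le_trans (fk k t kt) _; rewrite -mulrA ler_wpM2l//.
have tk : t / L < k.+1%:R by exact: truncnS_gt.
have -> : (2 ^+ k)^-1 = 2 * expR (- (k.+1%:R * ln 2)) :> R.
  by rewrite expRN expRM_natl lnK ?posrE// exprS invfM mulrA mulfV// mul1r.
by rewrite ler_wpM2l// ler_expR mulNr lerN2 mulrAC -mulrA mulrC ler_wpM2r ?ltW//.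
Qed.

Section decay.
Context (R : realType) (n m : nat) (A0 : 'M[R]_n) (A : 'I_m -> 'M[R]_n)
  (tau : 'I_m -> R) (X : R -> 'M[R]_n).
Hypothesis tau_gt0 : forall j, 0 < tau j.
Hypothesis hX : is_fundamental_matrix A0 A tau X.

(** In the variation of constants formula for X(t + s'), with s' a little later
    than s, all factors X(t - v) are at most e once t is large and all factors
    evaluated near s' are at most c, so |X(t + s')| <= kappa e c. The constant
    kappa collects the coefficients, the lengths of the integrals and the
    defect n of submultiplicativity of the maximum norm; e is chosen to make
    kappa e <= 1/2. *)
Lemma fundamental_matrix_halving :
  (forall e, 0 < e -> exists T, forall t, T <= t -> `|X t| <= e) ->
  exists2 L, 0 < L & forall s c, 0 <= s -> 0 <= c ->
    (forall t, s <= t -> `|X t| <= c) ->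
    forall t, s + L <= t -> `|X t| <= c / 2.
Proof.
move=> Xto0.
have [P [Pc P0 Pd Pr _]] := fundamental_matrix_primitive hX.
pose h := \sum_(j < m) tau j.
have h0 : 0 <= h by apply: sumr_ge0 => j _; exact: ltW.
have tauh j : tau j <= h.
  by rewrite /h (bigD1 j)//= lerDl sumr_ge0// => k _; exact: ltW.
pose kappa : R := n%:R + \sum_(j < m) n%:R * (n%:R * `|A j|) * tau j.
have kappa0 : 0 <= kappa.
  by rewrite addr_ge0// sumr_ge0// => j _; rewrite !mulr_ge0// ltW.
pose e := (2 * (kappa + 1))^-1.
have k1 : 0 < kappa + 1 by rewrite ltr_wpDl.
have e0 : 0 < e by rewrite invr_gt0 mulr_gt0.
have ke : kappa * e <= 2^-1.
  by rewrite /e invfM mulrCA ler_piMr// ler_pdivrMr// mul1r lerDl.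
have [T0 XT0] := Xto0 _ e0.
pose T := Num.max 0 T0.
have T0' : 0 <= T by rewrite le_max lexx.
have XT t : T <= t -> `|X t| <= e.
  by move=> Tt; apply: XT0; apply: le_trans Tt; rewrite le_max lexx orbT.
exists (h + (T + h) + 1); first by rewrite ltr_wpDl// !addr_ge0.
move=> s c s0 c0 Xsc w sw.
have [t [tTh ->]] : exists t, T + h <= t /\ w = t + (s + h).
  by exists (w - (s + h)); split; [lra|rewrite subrK].
have ht : h <= t by apply: le_trans tTh; rewrite lerDr.
have [J [J0 Jd ->]] := fundamental_matrix_variation_of_constants
  tau_gt0 hX Pc P0 Pd Pr h0 tauh ht
  (ltac:(by rewrite lerDr) : h <= s + h).
have Jj j : `|J j (tau j)| <= n%:R * (n%:R * e * `|A j|) * c * tau j.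
  rewrite -[X in `|X|]subr0 -{1}(J0 j) -[X in _ * X]subr0.
  apply: norm_le_of_has_rderiv; first exact: ltW.
    by move=> v v0 vt; apply: has_deriv_continuous (Jd j v v0 vt).
  move=> v v0 vt; eexists; first exact: has_deriv_has_rderiv (Jd j v v0 (ltW vt)).
  apply: le_trans (norm_mulmx_le _ _) _.
  apply: ler_pM => //.
    rewrite ler_wpM2l//; apply: le_trans (norm_mulmx_le _ _) _.
    rewrite ler_wpM2r// ler_wpM2l// XT//.
    by have := tauh j; lra.
  by apply: Xsc; have := tauh j; lra.
apply: (@le_trans _ _ (kappa * e * c)); last first.
  by rewrite mulrC ler_wpM2l.
apply: le_trans (ler_normD _ _) _; rewrite /kappa 2!mulrDl; apply: lerD.
  apply: le_trans (norm_mulmx_le _ _) _; apply: ler_pM => //.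
  - by rewrite ler_wpM2l// XT//; lra.
  - by apply: Xsc; lra.
apply: le_trans (ler_norm_sum _ _ _) _; rewrite !mulr_suml.
apply: ler_sum => j _; apply: le_trans (Jj j) _.
by rewrite le_eqVlt; apply/orP; left; apply/eqP; ring.
Qed.

Lemma fundamental_matrix_exp_decay :
  (forall e, 0 < e -> exists T, forall t, T <= t -> `|X t| <= e) ->
  exists alpha gamma : R, [/\ 0 < alpha, 0 <= gamma &
    forall t, 0 <= t -> `|X t| <= gamma * expR (- alpha * t)].
Proof.
move=> Xto0; have [L L0 Xhalf] := fundamental_matrix_halving Xto0.
have [T XT] := Xto0 1 ltr01.
have [||s _ smax] := @EVT_max R (fun t => `|X (Num.max 0 t)|) 0 (Num.max 0 T).
- by rewrite le_max lexx.
- apply: continuous_subspaceT => t; apply: cvg_norm.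
  exact: fundamental_matrix_clamp_continuous hX t.
pose M := Num.max 1 `|X (Num.max 0 s)|.
have M0 : 0 <= M by rewrite le_max ler01.
have XM t : 0 <= t -> `|X t| <= M.
  move=> t0; rewrite le_max; have [Tt|tT] := leP T t; first by rewrite XT.
  have := smax t; rewrite in_itv/= t0 le_max (ltW tT) orbT (max_r t0) => ->//.
  by rewrite orbT.
have [alpha alpha0 Xalpha] := exp_decay_of_halving L0 M0 XM Xhalf.
by exists alpha, (M * 2); split=> //; rewrite mulr_ge0.
Qed.

End decay.

(** * Equivalence of matrix norms *)

Lemma matrix_norm_le_max_norm (R : realType) (n : nat) (nrm : 'M[R]_n -> R) :
  is_matrix_norm nrm -> exists2 C, 0 <= C & forall M, nrm M <= C * `|M|.
Proof.
move=> [nrm0 _ nrmZ nrmD].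
exists (\sum_(i < n) \sum_(j < n) nrm (delta_mx i j)).
  by apply: sumr_ge0 => i _; apply: sumr_ge0.
have nrm_sum (F : 'I_n -> 'M[R]_n) : nrm (\sum_i F i) <= \sum_i nrm (F i).
  elim/big_ind2 : _ => // [|M x N y Mx Ny].
    by have := nrmZ 0 0; rewrite scale0r normr0 mul0r => ->.
  by apply: le_trans (nrmD _ _) _; exact: lerD.
move=> M; rewrite {1}(matrix_sum_delta M) mulr_suml.
apply: le_trans (nrm_sum _) _; apply: ler_sum => i _; rewrite mulr_suml.
apply: le_trans (nrm_sum _) _; apply: ler_sum => j _.
by rewrite nrmZ mulrC ler_wpM2l// entry_le_norm.
Qed.

(** By compactness the norm has a minimum on the unit sphere of the maximum norm,
    positive since the sphere avoids 0. Compactness of bounded closed sets is a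
    statement on row vectors, so matrices are flattened. *)
Lemma max_norm_le_matrix_norm (R : realType) (n : nat) (nrm : 'M[R]_n -> R) :
  is_matrix_norm nrm -> exists2 C, 0 <= C & forall M, `|M| <= C * nrm M.
Proof.
move=> hnrm; have [C C0 nrmC] := matrix_norm_le_max_norm hnrm.
have [nrm0 nrm_eq0 nrmZ nrmD] := hnrm.
have [[M0 M00]|noM] := pselect (exists M : 'M[R]_n, M != 0); last first.
  exists 0 => // M; rewrite mul0r normr_le0; apply/negP => /negP M0.
  by apply: noM; exists M.
have vec_le (v : 'rV[R]_(n * n)) : `|vec_mx v| <= `|v|.
  by apply: norm_le_entries => // i j; rewrite mxE entry_le_norm.
have mxvec_norm (M : 'M[R]_n) : `|mxvec M| = `|M|.
  apply/eqP; rewrite eq_le; apply/andP; split; last first.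
    by rewrite -{1}(mxvecK M) vec_le.
  apply: norm_le_entries => // i k; rewrite ord1.
  by case/mxvec_indexP: k => a b; rewrite mxvecE entry_le_norm.
pose S := [set v : 'rV[R]_(n * n) | `|v| = 1].
pose f (v : 'rV[R]_(n * n)) := nrm (vec_mx v).
have normalized (M : 'M[R]_n) : M != 0 -> S (`|M|^-1 *: mxvec M).
  move=> M_neq0; rewrite /S/= normrZ mxvec_norm normfV normr_id mulVf//.
  by rewrite normr_eq0.
have cS : compact S.
  apply: bounded_closed_compact.
    by exists 1; split => // x x1 v /= ->; exact: ltW.
  have -> : S = (fun v : 'rV[R]_(n * n) => `|v|) @^-1` [set 1] by [].
  apply: closed_comp; last exact: closed_eq.
  by move=> v _; exact: norm_continuous.
have fc : continuous f.
  move=> v; apply/(@cvgrPdist_le _ _ _ (nbhs (v : 'rV[R]_(n * n)))) => e e0; near=> w.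
  have nrmN M : nrm (- M) = nrm M by rewrite -scaleN1r nrmZ normrN1 mul1r.
  have nrmB M N : `|nrm M - nrm N| <= nrm (M - N).
    rewrite ler_norml; apply/andP; split.
      by rewrite lerNl opprB lerBlDr -(nrmN (M - N)) opprB
        (le_trans _ (nrmD _ _))// subrK.
    by rewrite lerBlDr (le_trans _ (nrmD _ _))// subrK.
  apply: le_trans (nrmB _ _) _; rewrite -raddfB /=.
  apply: le_trans (nrmC _) _.
  apply: (@le_trans _ _ ((C + 1) * `|v - w|)).
    by apply: ler_pM; rewrite ?vec_le// lerDl.
  rewrite -ler_pdivlMl ?ltr_wpDl//; near: w.
  apply: cvgr_dist_le; first exact: cvg_id.
  by rewrite mulr_gt0// invr_gt0 ltr_wpDl.
have [v0 v0S vmin] := compact_EVT_min (ex_intro S _ (normalized _ M00)) cS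
  (continuous_subspaceT fc).
rewrite inE /S /= in v0S.
have fv0 : 0 < f v0.
  rewrite lt_def nrm0 andbT; apply/eqP => /nrm_eq0 v00.
  have : v0 = 0 by rewrite -(vec_mxK v0) v00 linear0.
  by move: v0S => /[swap] ->; rewrite normr0 => /esym/eqP; rewrite oner_eq0.
exists (f v0)^-1; first by rewrite invr_ge0 ltW.
move=> M; have [->|M_neq0] := eqVneq M 0; first by rewrite normr0 mulr_ge0// invr_ge0 ltW.
have := vmin _ (mem_set (normalized _ M_neq0)).
rewrite {2}/f linearZ /= mxvecK nrmZ normfV normr_id.
have M_gt0 : 0 < `|M| by rewrite normr_gt0.
by rewrite ler_pdivlMl// mulrC ler_pdivlMl.
Unshelve. all: by end_near. Qed.

(** * The total integral and the stability criterion *)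

Lemma cvg_shift_pinfty (R : realType) (V : normedModType R) (F : R -> V) (L : V)
    (c : R) :
  F t @[t --> +oo] --> L -> F (t - c) @[t --> +oo] --> L.
Proof.
move=> /cvgrPdist_le FL; apply/cvgrPdist_le => e /FL [M [Mreal MF]].
exists (M + c); split; first exact: num_real.
by move=> t; rewrite -ltrBrDr => /MF.
Qed.

Lemma fundamental_matrix_unique (R : realType) (n m : nat) (A0 : 'M[R]_n)
    (A : 'I_m -> 'M[R]_n) (tau : 'I_m -> R) (X Y : R -> 'M[R]_n) :
  (forall j, 0 < tau j) ->
  is_fundamental_matrix A0 A tau X -> is_fundamental_matrix A0 A tau Y ->
  forall t, X t = Y t.
Proof.
move=> tau_gt0 hX hY t; apply/eqP; rewrite -subr_eq0; apply/eqP; move: t.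
have [_ Xd X0 X1] := hX; have [_ Yd Y0 Y1] := hY.
have W0 t : t <= 0 -> X t - Y t = 0.
  by rewrite le_eqVlt => /predU1P[->|t0]; rewrite ?X1 ?Y1 ?X0 ?Y0// subrr.
apply: (delay_solution_eq0 (A0 := A0) (A := A) tau_gt0) => // [|t t0].
  have -> : (fun t => X t - Y t) =
            (fun t : R => X (Num.max 0 t) - Y (Num.max 0 t)).
    apply/funext => t; have [//|t0] := leP 0 t.
    by rewrite !W0// ltW.
  move=> t; apply: cvgB.
    exact: (fundamental_matrix_clamp_continuous hX).
  exact: (fundamental_matrix_clamp_continuous hY).
by rewrite delay_leftD delay_leftN; apply: has_rderivB; [exact: Xd|exact: Yd].
Qed.

Section total_integral.
Context (R : realType) (n m : nat) (A0 : 'M[R]_n) (A : 'I_m -> 'M[R]_n)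
  (tau : 'I_m -> R) (X : R -> 'M[R]_n).
Hypothesis tau_gt0 : forall j, 0 < tau j.
Hypothesis hX : is_fundamental_matrix A0 A tau X.

Let S := A0 + \sum_(j < m) A j.

(** The integrated equation, rearranged so that the delays only enter through
    increments of P over windows of fixed length. *)
Lemma fundamental_matrix_balance (P : R -> 'M[R]_n) : continuous P ->
  (forall t, t <= 0 -> P t = 0) -> (forall t, has_rderiv P t (X t)) ->
  forall t, 0 <= t ->
    X t = 1%:M + S *m P t - \sum_(j < m) A j *m (P t - P (t - tau j)).
Proof.
move=> Pc P0 Pd t t0; rewrite (fundamental_matrix_integrated tau_gt0 hX Pc P0 Pd).
rewrite /heaviside t0 -addrA; congr (_ + _).
under [in RHS]eq_bigr do rewrite mulmxBr.
by rewrite sumrB /S mulmxDl mulmx_suml /delay_left opprB addrA addrAC addrK.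
Qed.

Lemma improper_integral_primitive (P : R -> 'M[R]_n) (L : 'M[R]_n) :
  (forall t i j, 0 <= t ->
    \int[@lebesgue_measure R]_(s in `[0, t]) X s i j = P t i j) ->
  improper_integral_eq X L <-> P t @[t --> +oo] --> L.
Proof.
move=> Pint.
have near_int i j : \forall t \near +oo,
    \int[@lebesgue_measure R]_(s in `[0, t]) X s i j = P t i j.
  by near=> t; apply: Pint; near: t; apply: nbhs_pinfty_ge; exact: num_real.
split=> [XL|PL i j].
  apply: cvg_mx_entries => i j; have := XL i j; apply: cvg_trans.
  exact/near_eq_cvg/near_int.
have Pij : P t i j @[t --> +oo] --> L i j by exact: cvg_entry.
apply: cvg_trans Pij.
by apply: near_eq_cvg; move: (near_int i j); apply: filterS => t ->.
Unshelve. all: by end_near. Qed.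

Lemma total_integral_of_cvg0 : X t @[t --> +oo] --> (0 : 'M[R]_n) ->
  S \in unitmx /\ improper_integral_eq X (- invmx S).
Proof.
move=> X0.
have [P [Pc Ppast Pd _ Pint]] := fundamental_matrix_primitive hX.
have PB j : P t - P (t - tau j) @[t --> +oo] --> (0 : 'M[R]_n).
  apply/cvgrPdist_le => e e0.
  have etau : 0 < e / tau j by rewrite divr_gt0.
  have [M [Mreal MX]] := (cvgrPdist_le _ _).1 X0 _ etau.
  near=> t; rewrite sub0r normrN -[leRHS](@divfK _ (tau j)) ?gt_eqF//.
  rewrite -[X in _ * X](subKr t); apply: norm_le_of_has_rderiv.
  - by rewrite gerBl ltW.
  - by move=> u _ _; exact: Pc.
  - move=> u tu ut; exists (X u); first exact: Pd.
    have := MX u; rewrite sub0r normrN; apply.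
    apply: lt_le_trans tu; rewrite ltrBrDr.
    by near: t; apply: nbhs_pinfty_gt; exact: num_real.
have SP : S *m P t @[t --> +oo] --> (- 1%:M : 'M[R]_n).
  have : X t - 1%:M + \sum_(j < m) A j *m (P t - P (t - tau j)) @[t --> +oo] -->
      0 - 1%:M + \sum_(j < m) A j *m 0.
    apply: cvgD; first by apply: cvgB => //; exact: cvg_cst.
    by apply: cvg_bigsum => j; apply: cvg_mulmx => //; exact: cvg_cst.
  rewrite big1 => [|j _]; last by rewrite mulmx0.
  rewrite sub0r addr0; apply: cvg_trans; apply: near_eq_cvg; near=> t.
  rewrite (fundamental_matrix_balance Pc Ppast Pd); last first.
    by near: t; apply: nbhs_pinfty_ge; exact: num_real.
  by rewrite addrAC subrK addrC addKr.
have Su : S \in unitmx.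
  (* the kernel annihilates S P(t), hence also its limit -I *)
  rewrite -row_free_unit -kermx_eq0; apply/eqP.
  have : kermx S *m (S *m P t) @[t --> +oo] --> kermx S *m (- 1%:M).
    by apply: cvg_mulmx => //; exact: cvg_cst.
  rewrite mulmxN mulmx1; under eq_cvg do rewrite mulmxA mulmx_ker mul0mx.
  move=> /(cvg_unique (@norm_hausdorff _ _))-/(_ _ (cvg_cst _)) K0.
  by rewrite -(opprK (kermx S)) K0 oppr0.
split=> //; apply/(improper_integral_primitive _ Pint).
have : invmx S *m (S *m P t) @[t --> +oo] --> invmx S *m (- 1%:M).
  by apply: cvg_mulmx => //; exact: cvg_cst.
by rewrite mulmxN mulmx1; under eq_cvg do rewrite mulKmx//.
Unshelve. all: by end_near. Qed.

Lemma cvg0_of_total_integral : S \in unitmx ->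
  improper_integral_eq X (- invmx S) -> X t @[t --> +oo] --> (0 : 'M[R]_n).
Proof.
move=> Su.
have [P [Pc Ppast Pd _ Pint]] := fundamental_matrix_primitive hX.
move=> /(improper_integral_primitive _ Pint) PL.
have : 1%:M + S *m P t - \sum_(j < m) A j *m (P t - P (t - tau j)) @[t --> +oo] -->
    1%:M + S *m (- invmx S) - \sum_(j < m) A j *m (- invmx S - - invmx S).
  apply: cvgB.
    by apply: cvgD; [exact: cvg_cst|apply: cvg_mulmx => //; exact: cvg_cst].
  apply: cvg_bigsum => j; apply: cvg_mulmx; first exact: cvg_cst.
  by apply: cvgB => //; exact: cvg_shift_pinfty.
rewrite mulmxN mulmxV// subrr sub0r big1 ?oppr0 => [|j _]; last first.
  by rewrite subrr mulmx0.
apply: cvg_trans; apply: near_eq_cvg; near=> t.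
by rewrite [RHS](fundamental_matrix_balance Pc Ppast Pd).
Unshelve. all: by end_near. Qed.

End total_integral.

Theorem theorem3p1 (R : realType) (n m : nat) (hn : (0 < n)%N) (hm : (0 < m)%N)
    (A0 : 'M[R]_n) (A : 'I_m -> 'M[R]_n) (tau : 'I_m -> R)
    (htau : forall j, 0 < tau j)
    (nrm : 'M[R]_n -> R) (hnrm : is_matrix_norm nrm)
    (X : R -> 'M[R]_n) (hX : is_fundamental_matrix A0 A tau X) :
  asymptotically_stable nrm A0 A tau <->
  (A0 + \sum_(j < m) A j \in unitmx /\
   improper_integral_eq X (- invmx (A0 + \sum_(j < m) A j))).
Proof.
split=> [[Y hY [alpha [gamma [alpha0 gamma0 Yexp]]]]|[Su XL]].
  have {Yexp} Xexp t : 0 <= t -> nrm (X t) <= gamma * expR (- alpha * t).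
    by rewrite (fundamental_matrix_unique htau hX hY); exact: Yexp.
  apply: (total_integral_of_cvg0 htau hX).
  have [C C0 nrmC] := max_norm_le_matrix_norm hnrm.
  apply/cvgrPdist_le => e e0; rewrite /prop_near1.
  have K0 : 0 < C * gamma + 1 by rewrite ltr_wpDl// mulr_ge0// ltW.
  have [M [_ ME]] := (cvgrPdist_le _ _).1 (@cvgr_expR R) _ (divr_gt0 e0 K0).
  near=> t; rewrite sub0r normrN.
  apply: le_trans (nrmC _) _.
  apply: (@le_trans _ _ (C * (gamma * expR (- alpha * t)))).
    by rewrite ler_wpM2l// Xexp//; near: t; apply: nbhs_pinfty_ge; exact: num_real.
  have : expR (- alpha * t) <= e / (C * gamma + 1).
    have := ME (alpha * t); rewrite sub0r normrN gtr0_norm ?expR_gt0// mulNr.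
    by apply; rewrite -ltr_pdivrMl//; near: t; apply: nbhs_pinfty_gt; exact: num_real.
  rewrite ler_pdivlMr// mulrC => /(le_trans _); apply.
  by rewrite mulrA ler_wpM2r ?expR_ge0// lerDl.
have X0 := cvg0_of_total_integral htau hX Su XL.
have [|alpha [gamma [alpha0 gamma0 Xexp]]] :=
    fundamental_matrix_exp_decay htau hX.
  move=> e /((cvgrPdist_le _ _).1 X0)[M [_ MX]]; exists (M + 1) => t Mt.
  have := MX t; rewrite sub0r normrN; apply.
  by apply: lt_le_trans Mt; rewrite ltrDl.
have [C C0 nrmC] := matrix_norm_le_max_norm hnrm.
exists X => //; exists alpha, (C * gamma + 1); split => //.
  by rewrite ltr_wpDl// mulr_ge0.
move=> t t0; apply: le_trans (nrmC _) _.
apply: (@le_trans _ _ (C * gamma * expR (- alpha * t))).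
  by rewrite -mulrA ler_wpM2l// Xexp.
by rewrite ler_wpM2r ?expR_ge0// lerDl.
Unshelve. all: by end_near. Qed.
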